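(* Let $\beta>0$ and $\varepsilon\in(0,1]$, and assume $p_{\mathrm{ref}}(q)>0$ for $\rho_{\mathcal Q}$-almost every $q$, where $p_{\mathrm{ref}}(q)=\mathbb{E}_{o\sim\pi_{\mathrm{ref}}(\cdot|q)}\mathbf{1}_{r(q,o)=1}$. For $a\in(0,1]$ define $$h_{\varepsilon,a}(p)=\frac{1}{1+\frac{1-a}{a}\exp\!\left(-\frac1\beta\frac{1}{\sqrt{p(1-p)+\varepsilon}}\right)},\qquad p\in[0,1].$$ Let $(\pi_n)_{n\ge0}$ be the GRPO iterates defined by $\pi_0=\pi_{\mathrm{ref}}$ and, for $n\ge1$, $$\pi_n\in\arg\max_{\pi}\ \mathbb{E}_{q\sim\rho_{\mathcal Q}}\Big\{\omega^+_\varepsilon(p_{n-1}(q))\,\mathbb{E}_{o\sim\pi(\cdot|q)}\mathbf{1}_{r(q,o)=1}-\omega^-_\varepsilon(p_{n-1}(q))\,\mathbb{E}_{o\sim\pi(\cdot|q)}\mathbf{1}_{r(q,o)=0}\Big\}-\beta\,\mathsf{KL}(\pi\|\pi_{\mathrm{ref}}),$$ where $p_{n}(q)=\mathbb{E}_{o\sim\pi_{n}(\cdot|q)}\mathbf{1}_{r(q,o)=1}$. Then $p_0(q)=p_{\mathrm{ref}}(q)$ and, for $\rho_{\mathcal Q}$-almost every $q$ and all $n\ge1$, $$p_n(q)=h_{\varepsilon,p_{\mathrm{ref}}(q)}(p_{n-1}(q)).$$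
   Context: $\rho_{\mathcal Q}$ is a probability distribution on the prompt space $\mathcal Q$; $\mathcal O$ is the outcome space with a fixed $\sigma$-finite base measure (counting measure when $\mathcal O$ is countable). A policy $\pi$ assigns (measurably) to each $q\in\mathcal Q$ a probability density $\pi(\cdot|q)$ on $\mathcal O$; the maximum is over all policies. The reward is a measurable function $r:\mathcal Q\times\mathcal O\to\{0,1\}$; $\pi_{\mathrm{ref}}$ is a fixed reference policy. $\mathsf{KL}(\pi\|\pi')=\mathbb{E}_{q\sim\rho_{\mathcal Q}}\mathbb{E}_{o\sim\pi(\cdot|q)}\log\frac{\pi(o|q)}{\pi'(o|q)}\in[0,\infty]$ (the objective is $-\infty$ when it is infinite). The weights are $\omega^+_{\varepsilon}(p)=\frac{1-p}{\sqrt{p(1-p)+\varepsilon}}$ and $\omega^-_{\varepsilon}(p)=\frac{p}{\sqrt{p(1-p)+\varepsilon}}$ for $p\in[0,1]$. *)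

(* Defs.v *)
From HB Require Import structures.
From mathcomp Require Import all_boot all_order all_algebra.
From mathcomp Require Import all_classical all_reals all_analysis.

Set Implicit Arguments.
Unset Strict Implicit.
Unset Printing Implicit Defensive.

Import Order.TTheory GRing.Theory Num.Theory.
Import numFieldNormedType.Exports.

Local Open Scope classical_set_scope.
Local Open Scope ring_scope.

Section grpo.
Context {dQ dO : measure_display} {Q : measurableType dQ}
  {O : measurableType dO} {R : realType}.

(* "Assigns measurably" is read as joint measurability of (q, o) |-> pi(o|q). *)
Record policy (mu : {sigma_finite_measure set O -> \bar R}) := Policy {
  density :> Q -> O -> R ;
  measurable_density : measurable_fun setT (fun x : Q * O => density x.1 x.2) ;
  density_ge0 : forall q o, 0 <= density q o ;
  integral_density : forall q, (\int[mu]_o (density q o)%:E = 1)%E }.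

Section objective.
Variable mu : {sigma_finite_measure set O -> \bar R}.
Implicit Types pi : policy mu.

Definition policy_expectation pi (q : Q) (f : O -> \bar R) : \bar R :=
  (\int[mu]_o ((pi q o)%:E * f o))%E.

(* The reward r takes values in {0, 1}, encoded by bool (true is 1). *)
Definition expected_success (r : Q -> O -> bool) pi (q : Q) : \bar R :=
  policy_expectation pi q (fun o => (r q o == true)%:R%:E).

Definition expected_failure (r : Q -> O -> bool) pi (q : Q) : \bar R :=
  policy_expectation pi q (fun o => (r q o == false)%:R%:E).

(* For measurable r the expectation lies in [0, 1], so fine loses nothing. *)
Definition success_prob (r : Q -> O -> bool) pi (q : Q) : R :=
  fine (expected_success r pi q).

(* In \bar R one has 0^-1 = +oo, lne +oo = +oo, lne 0 = -oo and 0 * x = 0.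
   Hence the integrand pi(o|q) * log (pi(o|q) / pi'(o|q)) is 0 where
   pi(o|q) = 0, and is +oo where pi(o|q) > 0 = pi'(o|q). Its negative part has
   mu-integral at most 1 since x * ln (x / y) >= x - y >= - y, so the inner
   integral is well defined and takes values in [0, +oo]. *)
Definition KL (rho : probability Q R) pi pi' : \bar R :=
  (\int[rho]_q policy_expectation pi q
     (fun o => lne ((pi q o)%:E / (pi' q o)%:E)))%E.

Definition weight_pos (eps p : R) : R := (1 - p) / Num.sqrt (p * (1 - p) + eps).

Definition weight_neg (eps p : R) : R := p / Num.sqrt (p * (1 - p) + eps).

(* The first integral is finite (its integrand is bounded), so the value is -oo
   exactly when KL is +oo. *)
Definition grpo_objective (rho : probability Q R) (r : Q -> O -> bool)
    (beta eps : R) (pi_ref pi_old pi : policy mu) : \bar R :=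
  (\int[rho]_q ((weight_pos eps (success_prob r pi_old q))%:E
                  * expected_success r pi q
                - (weight_neg eps (success_prob r pi_old q))%:E
                  * expected_failure r pi q)
   - beta%:E * KL rho pi pi_ref)%E.

Definition grpo_argmax (rho : probability Q R) (r : Q -> O -> bool)
    (beta eps : R) (pi_ref pi_old : policy mu) : set (policy mu) :=
  [set pi | forall pi' : policy mu,
     (grpo_objective rho r beta eps pi_ref pi_old pi'
        <= grpo_objective rho r beta eps pi_ref pi_old pi)%E].

End objective.

Definition grpo_map (beta eps a p : R) : R :=
  1 / (1 + (1 - a) / a
             * expR (- (1 / beta * (1 / Num.sqrt (p * (1 - p) + eps))))).

End grpo.

(* Main.v *)
(** Write T(q) for the success probability of the Gibbs policy proportional to
    pi_ref exp(A / beta), where the advantage A is w+ on successes and -w- on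
    failures; T(q) is h(p_old(q)) whenever p_ref(q) > 0. For fixed q, a policy
    with success probability P satisfies
      KL_q(pi, pi_ref) >= E_pi A / beta - log Z + (P - T)^2 / 2,
    while the Gibbs policy attains E A / beta - log Z. Comparing the objective of
    a maximizer with that of the Gibbs policy and integrating over q leaves
    E_q (P - T)^2 <= 0, so P = T almost surely. *)

Require Import Defs.
From HB Require Import structures.
From mathcomp Require Import all_boot all_order all_algebra.
From mathcomp Require Import all_classical all_reals all_analysis.
From mathcomp Require Import measurable_realfun.
From mathcomp Require Import ring lra.

Set Implicit Arguments.
Unset Strict Implicit.
Unset Printing Implicit Defensive.

Import Order.TTheory GRing.Theory Num.Theory.
Import numFieldNormedType.Exports.

Local Open Scope classical_set_scope.
Local Open Scope ring_scope.

(** * Elementary inequalities for integrals and logarithms *)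

(* Without measurability the integral is a lower integral of the positive part
   minus one of the negative part, so it is still monotone. *)
Lemma le_integral_pointwise d (T : measurableType d) (R : realType)
    (mu : {measure set T -> \bar R}) (f g : T -> \bar R) :
  (forall x, f x <= g x)%E -> (\int[mu]_x f x <= \int[mu]_x g x)%E.
Proof.
move=> fg; rewrite /integral !patch_setT.
have pos x : (f^\+ x <= g^\+ x)%E by apply: (@funepos_le _ _ setT) => //; rewrite in_setT.
have neg x : (g^\- x <= f^\- x)%E by apply: (@funeneg_le _ _ setT) => //; rewrite in_setT.
apply: leeB; apply: le_ereal_sup => _ [h /= hle <-]; exists h => //= x.
  exact: le_trans (pos x).
exact: le_trans (neg x).
Qed.

(** Fenchel-Young duality for the entropy: with w = ln (x / y) it reduces to exp (z - w) >= 1 + (z -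
    w). The dual variable [z] stays free, to be tuned later. *)
Lemma mul_ln_div_ge (R : realType) (x y z : R) : 0 <= x -> 0 <= y ->
  ((x * (1 + z) - y * expR z)%:E <= x%:E * lne (x%:E / y%:E))%E.
Proof.
move=> x0 y0; have [->|xn0] := eqVneq x 0.
  rewrite mul0e mul0r sub0r lee_fin oppr_le0.
  by rewrite mulr_ge0// expR_ge0.
have {xn0}xpos : 0 < x by rewrite lt_def xn0.
(* For y = 0 < x the conventions 0^-1 = +oo and lne +oo = +oo make the right side +oo. *)
have [->|yn0] := eqVneq y 0.
  by rewrite inve0 gt0_muley ?lte_fin// /= gt0_muley ?lte_fin// leey.
have {yn0}ypos : 0 < y by rewrite lt_def yn0.
rewrite inver gt_eqF// -EFinM lne_EFin ?divr_gt0// -EFinM lee_fin.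
set w := ln (x / y).
have -> : y * expR z = x * expR (z - w).
  rewrite expRD expRN lnK ?posrE ?divr_gt0//.
  by field; rewrite !gt_eqF.
rewrite -mulrBr ler_pM2l//.
have := expR_ge1Dx (z - w); lra.
Qed.

(** One has ln (1 + u) >= u / (1 + u), and u / (1 + u) exceeds u - 2 u^2 by u^2 (1 + 2 u) / (1 + u),
    which is nonnegative for u >= -1/2. *)
Lemma ln1D_ge (R : realType) (u : R) : - 2^-1 <= u ->
  u - 2 * u ^+ 2 <= ln (1 + u).
Proof.
move=> hu; have u1 : 0 < 1 + u by lra.
have ln_ge : 1 - (1 + u)^-1 <= ln (1 + u).
  have := @le_ln1Dx R ((1 + u)^-1 - 1).
  rewrite addrCA subrr addr0 lnV ?posrE// => /(_ _)/wrap[]; last by lra.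
  by rewrite ltrBDr addNr invr_gt0.
apply: le_trans ln_ge.
have -> : 1 - (1 + u)^-1 = u / (1 + u) by field; rewrite gt_eqF.
rewrite ler_pdivlMr//.
have : 0 <= u ^+ 2 * (1 + 2 * u) by rewrite mulr_ge0 ?sqr_ge0//; lra.
by rewrite !expr2; lra.
Qed.

(** * Integrals against a policy density, and the success probability *)

Section policies.
Context (R : realType) (dQ dO : measure_display).
Context (Q : measurableType dQ) (O : measurableType dO).
Variable mu : {sigma_finite_measure set O -> \bar R}.
Variable r : Q -> O -> bool.
Hypothesis r_meas : measurable_fun setT (fun x : Q * O => r x.1 x.2).
Implicit Types pi : policy (Q := Q) mu.

Local Notation success := (success_prob r).

Lemma measurable_reward q : measurable_fun setT (r q).
Proof. exact: (measurableT_comp r_meas (pair1_measurable q)). Qed.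

Lemma measurable_density_section pi q : measurable_fun setT (pi q).
Proof. exact: (measurableT_comp (measurable_density pi) (pair1_measurable q)). Qed.

Lemma integrable_density pi q : mu.-integrable setT (EFin \o pi q).
Proof.
apply/integrableP; split.
  exact/measurable_EFinP/measurable_density_section.
under eq_integral do rewrite /= ger0_norm ?density_ge0//.
by rewrite integral_density ltry.
Qed.

Lemma integrable_density_if pi q (x y : R) :
  mu.-integrable setT (fun o => (pi q o * (if r q o then x else y))%:E).
Proof.
apply: (le_integrable _ _ _
  (integrableZl measurableT (`|x| + `|y|) (integrable_density pi q))) => //.
  apply/measurable_EFinP; apply: measurable_funM; first exact: measurable_density_section.
  by apply: measurable_fun_ifT => //; exact: measurable_reward.
move=> o _ /=; rewrite lee_fin mulrC !normrM ler_wpM2r//.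
rewrite [leRHS]ger0_norm ?addr_ge0//.
by case: ifP => _; rewrite ?lerDl ?lerDr.
Qed.

Lemma expectation_indicE pi q b :
  policy_expectation pi q (fun o => (r q o == b)%:R%:E) =
  (\int[mu]_o (pi q o * (if r q o then b%:R else (~~ b)%:R))%:E)%E.
Proof.
by apply: eq_integral => o _; rewrite EFinM; case: (r q o) b => [] [].
Qed.

Lemma expectation_indic_fin_num pi q b :
  policy_expectation pi q (fun o => (r q o == b)%:R%:E) \is a fin_num.
Proof.
rewrite expectation_indicE; apply: integrable_fin_num => //.
exact: integrable_density_if.
Qed.

Lemma expected_successE pi q : expected_success r pi q = (success pi q)%:E.
Proof. by rewrite fineK// expectation_indic_fin_num. Qed.

(** An integrand depending on the outcome only through the reward splits into x - y times the
    success indicator plus the constant y. Later closed-form integrals over outcomes reduce to this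
    one. *)
Lemma integral_density_if pi q (x y : R) :
  (\int[mu]_o (pi q o * (if r q o then x else y))%:E =
   (success pi q * x + (1 - success pi q) * y)%:E)%E.
Proof.
transitivity (\int[mu]_o (((x - y) * (pi q o * (if r q o then 1 else 0)))%:E + (y * pi q o)%:E))%E.
  by apply: eq_integral => o _; rewrite -EFinD; congr EFin; case: (r q o); ring.
rewrite integralD_EFin//.
- under eq_integral do rewrite /= EFinM.
  under [X in (_ + X)%E]eq_integral do rewrite /= EFinM.
  rewrite !integralZl//; [|exact: integrable_density|exact: integrable_density_if].
  rewrite integral_density -(expectation_indicE pi q true).
  rewrite -/(expected_success r pi q) expected_successE -!EFinM -EFinD.
  by congr EFin; ring.
- exact: (integrableZl measurableT _ (integrable_density_if pi q 1 0)).
- exact: (integrableZl measurableT _ (integrable_density pi q)).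
Qed.

Lemma expected_failureE pi q : expected_failure r pi q = (1 - success pi q)%:E.
Proof.
rewrite /expected_failure expectation_indicE integral_density_if.
by rewrite mulr0 add0r mulr1.
Qed.

Lemma success_prob_ge0 pi q : 0 <= success pi q.
Proof.
apply: fine_ge0; apply: integral_ge0 => o _.
by rewrite mule_ge0// lee_fin ?density_ge0.
Qed.

Lemma success_prob_le1 pi q : success pi q <= 1.
Proof.
rewrite -subr_ge0 -lee_fin -expected_failureE; apply: integral_ge0 => o _.
by rewrite mule_ge0// lee_fin ?density_ge0.
Qed.

Lemma measurable_success_prob pi : measurable_fun setT (success pi).
Proof.
apply: (measurableT_comp (fine_measurable measurableT)).
apply: (measurable_fun_fubini_tonelli_F
  (fun x : Q * O => ((pi x.1 x.2)%:E * (r x.1 x.2 == true)%:R%:E)%E)).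
  apply: emeasurable_funM; apply/measurable_EFinP; first exact: measurable_density.
  rewrite (_ : (fun _ => _) = fun x : Q * O => if r x.1 x.2 then 1 else 0).
    exact: measurable_fun_ifT.
  by apply/funext => x; case: (r x.1 x.2).
by move=> x; rewrite mule_ge0// lee_fin ?density_ge0.
Qed.

(** * The Gibbs tilt of the reference policy *)

Section tilting.
Variables (pi_ref : policy (Q := Q) mu) (u1 u0 : Q -> R).
Hypotheses (mu1 : measurable_fun setT u1) (mu0 : measurable_fun setT u0).

(** The partition function Z of [pi_ref] weighted by exp u, where u is [u1] on successes and [u0] on
    failures. *)
Definition tilt_norm q : R :=
  success pi_ref q * expR (u1 q) + (1 - success pi_ref q) * expR (u0 q).

(** The density of the Gibbs policy relative to [pi_ref], kept as a single exponential so that its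
    logarithm is immediate. *)
Definition tilt_factor q (b : bool) : R :=
  if b then expR (u1 q - ln (tilt_norm q)) else expR (u0 q - ln (tilt_norm q)).

Definition tilt_success q : R := success pi_ref q * tilt_factor q true.

Lemma tilt_norm_gt0 q : 0 < tilt_norm q.
Proof.
(* The reference success probability may vanish at this prompt; the failure term then keeps Z
   positive. *)
have := success_prob_ge0 pi_ref q; rewrite le_eqVlt => /predU1P[a0|a0].
  by rewrite /tilt_norm -a0 mul0r subr0 mul1r add0r expR_gt0.
rewrite ltr_wpDr ?mulr_gt0 ?expR_gt0//.
by rewrite mulr_ge0 ?expR_ge0// subr_ge0 success_prob_le1.
Qed.

Lemma tilt_factorE q b :
  tilt_factor q b = expR (if b then u1 q else u0 q) / tilt_norm q.
Proof.
by case: b; rewrite /= expRD expRN lnK ?posrE ?tilt_norm_gt0.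
Qed.

Lemma onem_tilt_success q :
  1 - tilt_success q = (1 - success pi_ref q) * tilt_factor q false.
Proof.
rewrite /tilt_success !tilt_factorE.
have := tilt_norm_gt0 q; rewrite /tilt_norm /= => Z0.
by field; rewrite gt_eqF.
Qed.

Lemma tilt_success_ge0 q : 0 <= tilt_success q.
Proof. by rewrite mulr_ge0 ?success_prob_ge0 ?expR_ge0. Qed.

Lemma tilt_success_le1 q : tilt_success q <= 1.
Proof.
by rewrite -subr_ge0 onem_tilt_success mulr_ge0 ?expR_ge0// subr_ge0 success_prob_le1.
Qed.

Lemma measurable_ln_tilt_norm : measurable_fun setT (fun q => ln (tilt_norm q)).
Proof.
have ma := measurable_success_prob pi_ref.
apply: (measurableT_comp (@measurable_ln R)).
apply: measurable_funD; apply: measurable_funM => //.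
- exact: measurableT_comp.
- exact: measurable_funB.
- exact: measurableT_comp.
Qed.

Lemma measurable_tilt_factor b : measurable_fun setT (tilt_factor^~ b).
Proof.
have mlnZ := measurable_ln_tilt_norm.
by case: b; apply: (measurableT_comp (@measurable_expR R)); exact: measurable_funB.
Qed.

Lemma measurable_tilt_success : measurable_fun setT tilt_success.
Proof.
by apply: measurable_funM; [exact: measurable_success_prob|exact: measurable_tilt_factor].
Qed.

Definition tilted_density q o : R :=
  pi_ref q o * (if r q o then tilt_factor q true else tilt_factor q false).

Lemma measurable_tilted_density :
  measurable_fun setT (fun x : Q * O => tilted_density x.1 x.2).
Proof.
apply: measurable_funM; first exact: measurable_density.
have mc b : measurable_fun setT (fun x : Q * O => tilt_factor x.1 b).
  exact: (measurableT_comp (measurable_tilt_factor b) measurable_fst).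
exact: (measurable_fun_ifT r_meas (mc true) (mc false)).
Qed.

Lemma tilted_density_ge0 q o : 0 <= tilted_density q o.
Proof. by rewrite mulr_ge0 ?density_ge0//; case: ifP => _; exact: expR_ge0. Qed.

Lemma integral_tilted_density q : (\int[mu]_o (tilted_density q o)%:E = 1)%E.
Proof.
rewrite integral_density_if -onem_tilt_success.
by rewrite addrC subrK.
Qed.

Definition tilted_policy : policy mu :=
  Policy measurable_tilted_density tilted_density_ge0 integral_tilted_density.

Lemma success_prob_tilted q : success tilted_policy q = tilt_success q.
Proof.
rewrite /success_prob /expected_success (expectation_indicE _ _ true).
rewrite (_ : (\int[mu]_o _)%E =
    (\int[mu]_o (pi_ref q o * (if r q o then tilt_factor q true else 0))%:E)%E).
  by rewrite integral_density_if mulr0 addr0.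
apply: eq_integral => o _; congr EFin; rewrite /= /tilted_density.
by case: (r q o); rewrite ?mulr1 ?mulr0.
Qed.

(** * Divergence from the reference at a fixed prompt *)

Let KL_integral pi q : \bar R :=
  policy_expectation pi q (fun o => lne ((pi q o)%:E / (pi_ref q o)%:E)).

Lemma KL_integral_tilted q :
  (KL_integral tilted_policy q =
   (tilt_success q * u1 q + (1 - tilt_success q) * u0 q - ln (tilt_norm q))%:E)%E.
Proof.
transitivity (\int[mu]_o (tilted_policy q o *
    (if r q o then u1 q - ln (tilt_norm q) else u0 q - ln (tilt_norm q)))%:E)%E; last first.
  by rewrite integral_density_if success_prob_tilted; congr EFin; ring.
apply: eq_integral => o _; rewrite [in RHS]EFinM /= /tilted_density.
(* Where the reference density vanishes, so does the tilted one, and both integrands are 0. *)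
have [->|ref0] := eqVneq (pi_ref q o) 0; first by rewrite mul0r !mul0e.
have {ref0}ref_gt0 : 0 < pi_ref q o by rewrite lt_def ref0 density_ge0.
rewrite inver gt_eqF// -EFinM mulrAC divff ?gt_eqF// mul1r.
by case: (r q o); rewrite lne_EFin ?expR_gt0 ?expRK.
Qed.

(* Gibbs' inequality for the tilted policy, with an additional square. By
   duality KL dominates any functional that is affine in the densities;
   perturbing the optimal multipliers by 1 +- w yields the square. *)
Lemma KL_integral_ge pi q :
  ((success pi q * u1 q + (1 - success pi q) * u0 q - ln (tilt_norm q)
     + (success pi q - tilt_success q) ^+ 2 / 2)%:E <= KL_integral pi q)%E.
Proof.
set P := success pi q; set lnZ := ln (tilt_norm q).
(* With T the Gibbs success probability, the perturbation gains at least 2 w (P - T) - 2 w^2. This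
   [w] maximizes that gain, with value (P - T)^2 / 2, and satisfies |w| <= 1/2 as [ln1D_ge]
   requires. *)
set w := (P - tilt_success q) / 2.
have P0 : 0 <= P := success_prob_ge0 pi q.
have P1 : P <= 1 := success_prob_le1 pi q.
have T0 := tilt_success_ge0 q; have T1 := tilt_success_le1 q.
have w_ge : - 2^-1 <= w by rewrite /w; lra.
have w_le : w <= 2^-1 by rewrite /w; lra.
pose z (b : bool) := if b then u1 q - lnZ + ln (1 + w) else u0 q - lnZ + ln (1 - w).
have expz b : expR (z b) = tilt_factor q b * (if b then 1 + w else 1 - w).
  by case: b; rewrite /z expRD lnK// posrE; lra.
(* The logarithmic integrand may be +oo, so it is bounded below pointwise by the dual expression,
   which is integrable and has a closed form. *)
apply: (@le_trans _ _ (\int[mu]_o ((pi q o * (if r q o then 1 + z true else 1 + z false))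
    - (pi_ref q o * (if r q o then expR (z true) else expR (z false))))%:E)%E); last first.
  apply: le_integral_pointwise => o.
  apply: le_trans (@mul_ln_div_ge R _ _ (z (r q o)) (density_ge0 pi q o) (density_ge0 pi_ref q o)).
  by case: (r q o).
rewrite integralB_EFin//; try exact: integrable_density_if.
rewrite !integral_density_if -EFinB lee_fin -/P !expz !mulrA -onem_tilt_success.
rewrite -/(tilt_success q).
have lnp := ln1D_ge w_ge.
have lnm : - w - 2 * w ^+ 2 <= ln (1 - w) by rewrite -[w ^+ 2]sqrrN ln1D_ge// lerN2.
have P1' : 0 <= 1 - P by rewrite subr_ge0.
have := lerD (ler_wpM2l P0 lnp) (ler_wpM2l P1' lnm).
rewrite /z -/lnZ; move: (ln (1 + w)) (ln (1 - w)) => lp lm.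
have Pw : P = tilt_success q + 2 * w by rewrite /w; field.
rewrite {}Pw; move: (tilt_success q) => T; rewrite !expr2; lra.
Qed.

(** * Comparison of a maximizer with the Gibbs policy *)

Section maximizer.
Variables (rho : probability Q R) (M : R).
Hypotheses (u1_le : forall q, `|u1 q| <= M) (u0_le : forall q, `|u0 q| <= M).

(** Z is a convex combination of exp [u1] and exp [u0], both between exp (- M) and exp M. *)
Lemma ln_tilt_norm_le q : `|ln (tilt_norm q)| <= M.
Proof.
have a0 := success_prob_ge0 pi_ref q; have a1 := success_prob_le1 pi_ref q.
have [/andP[u1l u1u] /andP[u0l u0u]] : (- M <= u1 q <= M) /\ (- M <= u0 q <= M).
  by rewrite -!ler_norml.
have b0 : 0 <= 1 - success pi_ref q by rewrite subr_ge0.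
rewrite ler_norml -[X in X <= _]expRK -[X in _ && (_ <= X)]expRK.
rewrite !ler_ln ?posrE ?expR_gt0 ?tilt_norm_gt0// /tilt_norm.
rewrite -ler_expR in u1l; rewrite -ler_expR in u1u.
rewrite -ler_expR in u0l; rewrite -ler_expR in u0u.
have := (ler_wpM2l a0 u1l, ler_wpM2l b0 u0l, ler_wpM2l a0 u1u, ler_wpM2l b0 u0u).
move=> [[[]]]; lra.
Qed.

Lemma integrable_bounded (f : Q -> R) (B : R) : measurable_fun setT f ->
  (forall q, `|f q| <= B) -> rho.-integrable setT (EFin \o f).
Proof.
move=> mf fB; apply: measurable_bounded_integrable => //.
  exact: fin_num_fun_lty.
exists B; split; first exact: num_real.
by move=> x /ltW Bx q _; exact: le_trans (fB q) Bx.
Qed.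

(** With the tilts of [grpo_argmax_success] this is the expected advantage divided by beta, at
    success probability [p q]. *)
Let utility (p : Q -> R) q := p q * u1 q + (1 - p q) * u0 q.

Lemma integrable_utility (p : Q -> R) : measurable_fun setT p ->
  (forall q, 0 <= p q <= 1) -> rho.-integrable setT (EFin \o utility p).
Proof.
move=> mp p01; apply: (@integrable_bounded _ M).
  apply: measurable_funD; apply: measurable_funM => //.
  exact: measurable_funB.
move=> q; have /andP[p0 p1] := p01 q.
have := (u1_le q, u0_le q); rewrite !ler_norml => -[/andP[u1l u1u] /andP[u0l u0u]].
have p1' : 0 <= 1 - p q by rewrite subr_ge0.
have := (ler_wpM2l p0 u1l, ler_wpM2l p1' u0l, ler_wpM2l p0 u1u, ler_wpM2l p1' u0u).
by move=> [[[]]] *; apply/andP; rewrite /utility; lra.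
Qed.

Lemma grpo_argmax_success beta eps (pi_old pi : policy mu) : 0 < beta ->
  (forall q, u1 q = weight_pos eps (success pi_old q) / beta) ->
  (forall q, u0 q = - (weight_neg eps (success pi_old q) / beta)) ->
  grpo_argmax rho r beta eps pi_ref pi_old pi ->
  {ae rho, forall q, success pi q = tilt_success q}.
Proof.
move=> beta0 u1E u0E /(_ tilted_policy).
have mlnZ := measurable_ln_tilt_norm.
have mP pi' := measurable_success_prob pi'.
have P01 pi' q : 0 <= success pi' q <= 1 by rewrite success_prob_ge0 success_prob_le1.
have mT := measurable_tilt_success.
pose lnZ q := ln (tilt_norm q).
pose sq q := (success pi q - tilt_success q) ^+ 2.
have msq : measurable_fun setT sq by apply: measurable_funX; exact: measurable_funB.
have ilnZ : rho.-integrable setT (EFin \o lnZ) := integrable_bounded mlnZ ln_tilt_norm_le.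
have isq : rho.-integrable setT (EFin \o sq).
  apply: (@integrable_bounded _ 1) => // q; rewrite normrX exprn_ile1// ler_norml.
  have := (P01 pi q, tilt_success_ge0 q, tilt_success_le1 q).
  by move=> [[/andP[? ?] ?] ?]; apply/andP; lra.
have isq2 : rho.-integrable setT (EFin \o (fun q => sq q / 2)).
  exact: (integrableZr measurableT 2^-1 isq).
have iU pi' : rho.-integrable setT (EFin \o utility (success pi')).
  exact: integrable_utility.
have EI (f : Q -> R) : rho.-integrable setT (EFin \o f) ->
    (\int[rho]_q (f q)%:E = (Rintegral rho setT f)%:E)%E.
  by move=> fi; rewrite fineK// integrable_fin_num.
(* The objective is beta times the mean utility minus beta times KL. *)
have objE pi' : (grpo_objective rho r beta eps pi_ref pi_old pi' =
    (beta * Rintegral rho setT (utility (success pi')))%:E - beta%:E * KL rho pi' pi_ref)%E.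
  rewrite /grpo_objective EFinM -EI// -(integralZl measurableT (iU pi')).
  congr (_ - _)%E; apply: eq_integral => q _ /=.
  rewrite expected_successE expected_failureE -!EFinM -EFinB.
  by congr EFin; rewrite /utility u1E u0E; field; rewrite gt_eqF.
have KLT : KL rho tilted_policy pi_ref =
    (Rintegral rho setT (utility (success tilted_policy)) - Rintegral rho setT lnZ)%:E.
  rewrite EFinB -!EI// -integralB_EFin//.
  apply: eq_integral => q _; rewrite -EFinB -/(KL_integral _ _) KL_integral_tilted.
  by rewrite /utility success_prob_tilted.
(* The divergence of the maximizer is not known to be finite, so it enters only through a lower
   bound; every other term is a real number. *)
have KLpi : ((Rintegral rho setT (utility (success pi)) - Rintegral rho setT lnZ +
    Rintegral rho setT sq / 2)%:E <= KL rho pi pi_ref)%E.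
  have igap := integrableB measurableT (iU pi) ilnZ.
  rewrite -(RintegralB measurableT (iU pi) ilnZ) -(RintegralZr 2^-1 measurableT isq).
  rewrite -(RintegralD measurableT igap isq2) -EI; last first.
    exact: (integrableD measurableT igap isq2).
  by apply: le_integral_pointwise => q; exact: KL_integral_ge.
rewrite !objE {}KLT => obj_le.
have {obj_le} : ((beta * Rintegral rho setT (utility (success tilted_policy)))%:E -
    beta%:E * (Rintegral rho setT (utility (success tilted_policy)) - Rintegral rho setT lnZ)%:E
  <= (beta * Rintegral rho setT (utility (success pi)))%:E -
    beta%:E * (Rintegral rho setT (utility (success pi)) - Rintegral rho setT lnZ +
    Rintegral rho setT sq / 2)%:E)%E.
  by apply: le_trans obj_le _; rewrite leeB// lee_pmul2l.
(* The utilities cancel on each side and beta E ln Z is common to both, leaving 0 <= - beta E sq /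
   2. *)
rewrite -!EFinM -!EFinB lee_fin => obj_le.
have sq_le0 : Rintegral rho setT sq <= 0.
  rewrite -(pmulr_rle0 _ beta0); lra.
have sq_eq0 : (\int[rho]_q `|(sq q)%:E| = 0)%E.
  under eq_integral do rewrite /= ger0_norm ?sqr_ge0//.
  rewrite EI//; congr EFin; apply/eqP.
  by rewrite eq_le sq_le0 Rintegral_ge0// => q _; exact: sqr_ge0.
have msqE : measurable_fun setT (EFin \o sq) by exact/measurable_EFinP.
move/(ae_eq_integral_abs rho measurableT msqE) : sq_eq0.
apply: filterS => q /(_ I) /= -[] /eqP.
by rewrite sqrf_eq0 subr_eq0 => /eqP.
Qed.

End maximizer.
End tilting.

(** * Identification with the GRPO map, and regularity of the weights *)

Lemma tilt_successE beta eps (pi_ref : policy mu) (p : Q -> R) q :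
  0 < success pi_ref q ->
  tilt_success pi_ref (fun q => weight_pos eps (p q) / beta)
    (fun q => - (weight_neg eps (p q) / beta)) q =
  grpo_map beta eps (success pi_ref q) (p q).
Proof.
move=> a_gt0; rewrite /tilt_success tilt_factorE /grpo_map /tilt_norm.
(* The numerators 1 - p and p of the two weights add up to 1, so the exponent of [grpo_map] is the
   failure tilt minus the success tilt. Dividing by the success term of Z then gives the map. *)
rewrite (_ : - (1 / beta * _) =
    - (weight_neg eps (p q) / beta) - weight_pos eps (p q) / beta); last first.
  by rewrite /weight_neg /weight_pos; ring.
rewrite expRD (expRN (weight_pos _ _ / _)).
have a1 := success_prob_le1 pi_ref q.
set e1 := expR (weight_pos _ _ / _); set e0 := expR (- _).
have e1_gt0 : 0 < e1 := expR_gt0 _; have e0_gt0 : 0 < e0 := expR_gt0 _.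
have D_gt0 : 0 < success pi_ref q * e1 + (1 - success pi_ref q) * e0.
  by rewrite ltr_wpDr ?mulr_gt0// mulr_ge0 ?subr_ge0 ?expR_ge0.
by field; rewrite !gt_eqF.
Qed.

End policies.

Lemma measurable_invsqrt_weight d (T : measurableType d) (R : realType) (eps : R)
    (p : T -> R) : 0 < eps -> measurable_fun setT p -> (forall t, 0 <= p t <= 1) ->
  measurable_fun setT (fun t => (Num.sqrt (p t * (1 - p t) + eps))^-1).
Proof.
move=> eps0 mp p01.
(* Real powers are measurable, and the radicand is nonnegative, so the inverse root is its power of
   exponent -1/2. *)
rewrite (_ : (fun _ => _) = fun t => (p t * (1 - p t) + eps) `^ (- 2^-1)).
  apply: (measurableT_comp (measurable_powR _)).
  apply: measurable_funD => //; apply: measurable_funM => //.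
  exact: measurable_funB.
apply/funext => t; rewrite powRN powR12_sqrt//.
have /andP[p0 p1] := p01 t.
by rewrite addr_ge0 ?(ltW eps0)// mulr_ge0// subr_ge0.
Qed.

Lemma invsqrt_weight_le (R : realType) (eps p : R) : 0 < eps -> 0 <= p <= 1 ->
  (Num.sqrt (p * (1 - p) + eps))^-1 <= (Num.sqrt eps)^-1.
Proof.
move=> eps0 /andP[p0 p1].
have pp : 0 <= p * (1 - p) by rewrite mulr_ge0// subr_ge0.
have sum_gt0 : 0 < p * (1 - p) + eps by rewrite ltr_wpDl.
by rewrite lef_pV2 ?posrE ?sqrtr_gt0// ler_wsqrtr// lerDr.
Qed.

(** Taking [c] to be 1 - p or p covers both weights, so a single bound serves both tilts. *)
Lemma norm_weight_le (R : realType) (eps p c beta : R) : 0 < eps -> 0 < beta ->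
  0 <= p <= 1 -> 0 <= c <= 1 ->
  `|c / Num.sqrt (p * (1 - p) + eps) / beta| <= (Num.sqrt eps)^-1 / beta.
Proof.
move=> eps0 beta0 p01 /andP[c0 c1].
rewrite ger0_norm; last by rewrite !divr_ge0 ?sqrtr_ge0 ?(ltW beta0).
rewrite ler_pM2r ?invr_gt0//; apply: le_trans (invsqrt_weight_le eps0 p01).
by rewrite ler_piMl ?invr_ge0 ?sqrtr_ge0.
Qed.

Theorem theorem2 (R : realType) (dQ dO : measure_display)
    (Q : measurableType dQ) (O : measurableType dO)
    (rho : probability Q R) (mu : {sigma_finite_measure set O -> \bar R})
    (r : Q -> O -> bool)
    (r_meas : measurable_fun setT (fun x : Q * O => r x.1 x.2))
    (beta eps : R) (beta_gt0 : 0 < beta) (eps_gt0 : 0 < eps) (eps_le1 : eps <= 1)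
    (pi_ref : policy (Q := Q) mu)
    (p_ref_gt0 : {ae rho, forall q, 0 < success_prob r pi_ref q})
    (pi : nat -> policy (Q := Q) mu)
    (pi0 : pi 0%N = pi_ref)
    (piS : forall n : nat, (1 <= n)%N ->
       grpo_argmax rho r beta eps pi_ref (pi n.-1) (pi n)) :
  (forall q, success_prob r (pi 0%N) q = success_prob r pi_ref q) /\
  {ae rho, forall q, forall n : nat, (1 <= n)%N ->
     success_prob r (pi n) q =
       grpo_map beta eps (success_prob r pi_ref q) (success_prob r (pi n.-1) q)}.
Proof.
split=> [q|]; first by rewrite pi0.
(* Countably many null sets have a null union, so the index can be fixed first; index 0 is
   vacuous. *)
apply/ae_foralln => -[|n]; first by apply: aeW => q.
pose p := success_prob r (pi n).
have p01 q : 0 <= p q <= 1 by rewrite success_prob_ge0 ?success_prob_le1.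
have onem_p01 q : 0 <= 1 - p q <= 1 by have /andP[] := p01 q; lra.
have mp : measurable_fun setT p := measurable_success_prob r_meas (pi n).
have ms := measurable_invsqrt_weight eps_gt0 mp p01.
have mu1 : measurable_fun setT (fun q => weight_pos eps (p q) / beta).
  apply: measurable_funM => //; apply: measurable_funM => //.
  exact: measurable_funB.
have mu0 : measurable_fun setT (fun q => - (weight_neg eps (p q) / beta)).
  apply: measurableT_comp => //; apply: measurable_funM => //.
  exact: measurable_funM.
have step := grpo_argmax_success r_meas mu1 mu0
  (fun q => norm_weight_le eps_gt0 beta_gt0 (p01 q) (onem_p01 q)) _ beta_gt0
  (fun=> erefl) (fun=> erefl) (piS n.+1 isT).
have {step} : {ae rho, forall q, success_prob r (pi n.+1) q =
   tilt_success r pi_ref (fun q => weight_pos eps (p q) / beta)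
    (fun q => - (weight_neg eps (p q) / beta)) q}.
  apply: step => q; rewrite normrN; exact: norm_weight_le.
(* The Gibbs success probability agrees with [grpo_map] where the reference success probability is
   positive, hence almost everywhere. *)
apply: filterS2 p_ref_gt0 => q a_gt0 -> _.
by rewrite tilt_successE.
Qed.
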